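(* Let $\mathbb{F}$ be an algebraically closed field, let $d \geq 1$ be an integer, and let $\Phi = (A, \{E_i\}_{i=0}^d, A^*, \{E^*_i\}_{i=0}^d)$ be a Leonard system over $\mathbb{F}$ with diameter $d$. Let $\{\theta_i\}_{i=0}^d$ (resp. $\{\theta^*_i\}_{i=0}^d$) be the eigenvalues of $A$ (resp. $A^*$), with $\theta_i$ associated with $E_i$ and $\theta^*_i$ associated with $E^*_i$, and let $\{a_i\}_{i=0}^d$ (resp. $\{a^*_i\}_{i=0}^d$) be the principal sequence (resp. dual principal sequence) of $\Phi$. Then \[ \frac{(a_0-\theta_0)(a_d-\theta_d)}{(a_0-\theta_d)(a_d-\theta_0)} = \frac{(a^*_0-\theta^*_0)(a^*_d-\theta^*_d)}{(a^*_0-\theta^*_d)(a^*_d-\theta^*_0)}, \] where all the denominators are nonzero. Once we fix $\theta_0, \theta_d, \theta^*_0, \theta^*_d$, any one of $a_0, a_d, a^*_0, a^*_d$ is determined by the remaining three; that is, if two Leonard systems over $\mathbb{F}$ with diameter $d$ have the same $\theta_0, \theta_d, \theta^*_0, \theta^*_d$ and agree on three of the four scalars $a_0, a_d, a^*_0, a^*_d$, then they agree on the fourth.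
   Context: Let $\mathbb{F}$ be an algebraically closed field, $d\ge 0$ an integer, and $V$ a vector space over $\mathbb{F}$ of dimension $d+1$. A square matrix is tridiagonal if every nonzero entry lies on the diagonal, the subdiagonal or the superdiagonal; a tridiagonal matrix is irreducible if all entries on the subdiagonal and on the superdiagonal are nonzero. A Leonard pair on $V$ is an ordered pair of linear maps $A: V\to V$, $A^*: V\to V$ ($A^*$ is just a second map, not an adjoint) such that (i) there is a basis of $V$ with respect to which the matrix of $A$ is irreducible tridiagonal and the matrix of $A^*$ is diagonal; (ii) there is a basis of $V$ with respect to which the matrix of $A^*$ is irreducible tridiagonal and the matrix of $A$ is diagonal. It is known that each of $A, A^*$ then has $d+1$ mutually distinct eigenvalues. The primitive idempotent of $A$ associated with an eigenvalue $\theta$ is the linear map acting as the identity on the $\theta$-eigenspace and as $0$ on the other eigenspaces; similarly for $A^*$. An ordering $\{E_i\}_{i=0}^d$ of the primitive idempotents of $A$ is standard if, for nonzero $v_i\in E_iV$, the basis $\{v_i\}_{i=0}^d$ satisfies (ii) (i.e. $A^*$ is irreducible tridiagonal with respect to it); an ordering $\{E^*_i\}_{i=0}^d$ of the primitive idempotents of $A^*$ is standard if, for nonzero $v^*_i\in E^*_iV$, the basis $\{v^*_i\}_{i=0}^d$ satisfies (i). A Leonard system on $V$ (over $\mathbb{F}$, with diameter $d$) is a sequence $\Phi=(A,\{E_i\}_{i=0}^d,A^*,\{E^*_i\}_{i=0}^d)$ where $A,A^*$ is a Leonard pair on $V$ and $\{E_i\}_{i=0}^d$, $\{E^*_i\}_{i=0}^d$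 are standard orderings of the primitive idempotents of $A$, $A^*$ respectively. The principal sequence of $\Phi$ is $\{a_i\}_{i=0}^d$ with $a_i=\mathrm{tr}(AE^*_i)$, and the dual principal sequence is $\{a^*_i\}_{i=0}^d$ with $a^*_i=\mathrm{tr}(A^*E_i)$, where $\mathrm{tr}$ denotes trace. *)

(* Defs.v *)
From HB Require Import structures.
From mathcomp Require Import all_boot all_order all_algebra.

Set Implicit Arguments.
Unset Strict Implicit.
Unset Printing Implicit Defensive.

Import GRing.Theory passmx.
Local Open Scope ring_scope.

Section Tridiagonal.
Variables (F : fieldType) (n : nat).

Definition is_tridiag_mx (M : 'M[F]_n) : Prop :=
  forall i j : 'I_n, M i j != 0 ->
    [|| (i : nat) == j, (i : nat) == j.+1 | (j : nat) == i.+1].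

Definition is_irr_tridiag_mx (M : 'M[F]_n) : Prop :=
  is_tridiag_mx M /\
  (forall i j : 'I_n, ((i : nat) == j.+1) || ((j : nat) == i.+1) ->
     M i j != 0).

End Tridiagonal.

Section LinearMaps.
Variables (F : fieldType) (V : vectType F).

(* Column convention: f e_j = \sum_i (lfun_mx e f i j) e_i when e is a basis.
   (The library's mxof acts on row vectors and is tied to \dim.) *)
Definition lfun_mx n (e : n.-tuple V) (f : 'End(V)) : 'M[F]_n :=
  \matrix_(i, j) coord e i (f e`_j).

Definition lfun_tr (f : 'End(V)) : F := \tr (lfun_mx (vbasis {:V}) f).

Definition is_primitive_idempotent (A : 'End(V)) (theta : F) (E : 'End(V))
  : Prop :=
  [/\ leigenvalue A theta,
      forall v, v \in leigenspace A theta -> E v = v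
    & forall mu v, mu != theta -> v \in leigenspace A mu -> E v = 0].

(* E_0, ..., E_d lists every primitive idempotent of A exactly once. *)
Definition is_idempotent_ordering d (A : 'End(V)) (E : 'I_d.+1 -> 'End(V))
  : Prop :=
  injective E /\
  (forall P : 'End(V),
     (exists theta, is_primitive_idempotent A theta P) <->
     (exists i, P = E i)).

(* e is a basis with respect to which A is irreducible tridiagonal and B is
   diagonal; condition (i) of a Leonard pair is about (A, A^* ), condition (ii)
   about (A^*, A). *)
Definition is_leonard_basis n (A B : 'End(V)) (e : n.-tuple V) : Prop :=
  [/\ basis_of {:V} e, is_irr_tridiag_mx (lfun_mx e A)
    & is_diag_mx (lfun_mx e B)].

(* The bases having d.+1 elements forces \dim {:V} = d.+1, see
   leonard_pair_dim. *)
Definition is_leonard_pair d (A As : 'End(V)) : Prop :=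
  (exists e : d.+1.-tuple V, is_leonard_basis A As e) /\
  (exists e : d.+1.-tuple V, is_leonard_basis As A e).

Lemma leonard_pair_dim d (A As : 'End(V)) :
  is_leonard_pair d A As -> \dim {:V} = d.+1.
Proof. by case=> [[e [be _ _]] _]; rewrite -(size_basis be). Qed.

(* E is a standard ordering of the primitive idempotents of A, B being the
   other map of the pair. *)
Definition is_standard_ordering d (A B : 'End(V)) (E : 'I_d.+1 -> 'End(V))
  : Prop :=
  is_idempotent_ordering A E /\
  (forall v : d.+1.-tuple V,
     (forall i, tnth v i != 0 /\ tnth v i \in limg (E i)) ->
     is_leonard_basis B A v).

End LinearMaps.

Record leonard_system (F : fieldType) (d : nat) (V : vectType F) :=
  LeonardSystem {
    lsA : 'End(V);
    lsE : 'I_d.+1 -> 'End(V);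
    lsAs : 'End(V);
    lsEs : 'I_d.+1 -> 'End(V);
    ls_pair : is_leonard_pair d lsA lsAs;
    ls_standard : is_standard_ordering lsA lsAs lsE;
    ls_dual_standard : is_standard_ordering lsAs lsA lsEs
  }.

Section Sequences.
Variables (F : fieldType) (d : nat) (V : vectType F).
Variable Phi : leonard_system d V.

Definition is_eigenvalue_seq (theta : 'I_d.+1 -> F) : Prop :=
  forall i, is_primitive_idempotent (lsA Phi) (theta i) (lsE Phi i).

Definition is_dual_eigenvalue_seq (thetas : 'I_d.+1 -> F) : Prop :=
  forall i, is_primitive_idempotent (lsAs Phi) (thetas i) (lsEs Phi i).

Definition principal_seq (i : 'I_d.+1) : F :=
  lfun_tr (lsA Phi \o lsEs Phi i)%VF.

Definition dual_principal_seq (i : 'I_d.+1) : F :=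
  lfun_tr (lsAs Phi \o lsE Phi i)%VF.

End Sequences.

(* Main.v *)
(* Let [C] be the transition matrix between eigenbases of [A] and [A^*]: in one
   [A] is tridiagonal with diagonal [a_i], in the other [A^*] is tridiagonal
   with diagonal [a^*_i].  Comparing the corner entries of the two intertwining
   relations gives
     (theta^*_0 - theta^*_1) (a_0 - theta_0)
       = (theta_0 - theta_1) (a^*_0 - theta^*_0),
   and, since row 0 of [C] has no zero entry, a_0 <> theta_0.  Reversing either
   or both of the orderings yields three more identities, involving the same
   four eigenvalue differences; the quotient of products of the four identities
   is the claimed equality.  Its left side is an injective Moebius function of
   each [a_i], which gives the uniqueness part. *)
Require Import Defs.
From mathcomp Require Import all_boot all_order all_algebra.
From mathcomp Require Import zify ring.
Import GRing.Theory.
Local Open Scope ring_scope.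

Set Implicit Arguments.
Unset Strict Implicit.
Unset Printing Implicit Defensive.

(* [C] is the transition matrix from the basis diagonalizing [A^*] (where [A]
   is [M]) to the basis diagonalizing [A] (where [A^*] is [N]). *)
Record leonard_transition (F : fieldType) d (M N C : 'M[F]_d.+1)
    (th ths : 'I_d.+1 -> F) : Prop := LeonardTransition {
  lt_irrM : is_irr_tridiag_mx M;
  lt_irrN : is_irr_tridiag_mx N;
  lt_th_inj : injective th;
  lt_ths_inj : injective ths;
  lt_col_neq0 : forall j, exists i, C i j != 0;
  lt_mulM : forall i j, \sum_k C i k * M k j = th i * C i j;
  lt_mulN : forall i j, \sum_k N i k * C k j = C i j * ths j
}.

(** * The corner identity for a transition matrix *)

Lemma sum_ord_first2 (V : nmodType) d (f : 'I_d.+1 -> V) (i1 : 'I_d.+1) :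
  i1 = 1%N :> nat -> (forall k : 'I_d.+1, (1 < k)%N -> f k = 0) ->
  \sum_k f k = f ord0 + f i1.
Proof.
move=> i1E f0; have i1n0 : i1 != ord0 by rewrite -val_eqE /= i1E.
rewrite (bigD1 ord0) //= (bigD1 i1) //= big1 ?addr0 // => k /andP[k0 k1].
apply: f0; move: k0 k1; rewrite -!val_eqE /= i1E.
by case: (val k) => [|[]].
Qed.

Lemma tridiag_far_eq0 (F : fieldType) n (M : 'M[F]_n) (i j : 'I_n) :
  is_tridiag_mx M -> (i.+1 < j)%N || (j.+1 < i)%N -> M i j = 0.
Proof.
move=> triM far; apply/eqP; apply: contraLR far => /triM.
by case/or3P=> /eqP; lia.
Qed.

(** Row [p] of the eigenvector equation gives [N p (p+1) * c (p+1)] in terms of earlier entries of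
    [c]; the superdiagonal being nonzero, entry 0 determines the whole eigenvector. *)
Lemma irr_tridiag_ker_eq0 (F : fieldType) d (N : 'M[F]_d.+1) (c : 'I_d.+1 -> F)
    (t : F) :
  is_irr_tridiag_mx N -> (forall i, \sum_k N i k * c k = c i * t) ->
  c ord0 = 0 -> forall i, c i = 0.
Proof.
move=> [triN irrN] Nc c0 i.
have [m] := ubnP (val i); elim: m i => // m IHm i; rewrite ltnS => le_im.
have [i0 | i_gt0] := posnP i; first by rewrite (_ : i = ord0) //; apply: val_inj.
have ltp : (i.-1 < d.+1)%N by rewrite (leq_ltn_trans (leq_pred i)).
pose p := Ordinal ltp.
have pE : val i = p.+1 by rewrite /= prednK.
have := Nc p; rewrite (IHm p) ?mul0r; last by rewrite (leq_trans _ le_im) // pE.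
rewrite (bigD1 i) //= big1 ?addr0 => [/eqP|k ki].
  rewrite mulf_eq0 => /orP[|/eqP //].
  by rewrite (negPf (irrN p i _)) // pE eqxx orbT.
have [lt_ki | le_ik] := ltnP k i.
  by rewrite IHm ?mulr0 // (leq_trans lt_ki).
have ltk : (p.+1 < k)%N by move: ki; rewrite -val_eqE /=; lia.
by rewrite (tridiag_far_eq0 triN) ?mul0r // ltk.
Qed.

(** Each column of [C] is a nonzero eigenvector of [N], so it cannot start with 0. *)
Lemma transition_row0_neq0 (F : fieldType) d (M N C : 'M[F]_d.+1)
    (th ths : 'I_d.+1 -> F) :
  leonard_transition M N C th ths -> forall j, C ord0 j != 0.
Proof.
move=> lt j; apply/eqP => c0; have [i /eqP[]] := lt_col_neq0 lt j.
exact: (irr_tridiag_ker_eq0 (c := C ^~ j) (lt_irrN lt)) (lt_mulN lt ^~ j) c0 i.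
Qed.

(* Both sides are the first split parameter of the Leonard system. *)
Lemma transition_corner (F : fieldType) d (M N C : 'M[F]_d.+1)
    (th ths : 'I_d.+1 -> F) (i1 : 'I_d.+1) :
  leonard_transition M N C th ths -> i1 = 1%N :> nat ->
  M ord0 ord0 != th ord0 /\
  (ths ord0 - ths i1) * (M ord0 ord0 - th ord0) =
  (th ord0 - th i1) * (N ord0 ord0 - ths ord0).
Proof.
move=> lt i1E; have C0 := transition_row0_neq0 lt.
have [triM irrM] := lt_irrM lt; have [triN irrN] := lt_irrN lt.
have colM i : C i ord0 * M ord0 ord0 + C i i1 * M i1 ord0 = th i * C i ord0.
  rewrite -(lt_mulM lt) (sum_ord_first2 i1E) // => k k1.
  by rewrite (tridiag_far_eq0 triM) ?mulr0 //= k1 orbT.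
have rowN j : N ord0 ord0 * C ord0 j + N ord0 i1 * C i1 j = C ord0 j * ths j.
  rewrite -(lt_mulN lt) (sum_ord_first2 i1E) // => k k1.
  by rewrite (tridiag_far_eq0 triN) ?mul0r //= k1.
have M10 : M i1 ord0 != 0 by apply: irrM; rewrite i1E.
have e1 := colM ord0; have e2 := colM i1.
have e3 := rowN ord0; have e4 := rowN i1.
split.
  (* If [M 0 0 = th 0], then [e1] leaves [C 0 1 * M 1 0 = 0], although both factors are nonzero. *)
  apply/eqP => M00; have /eqP := e1; rewrite M00 mulrC -subr_eq0 addrAC subrr add0r.
  by rewrite mulf_eq0 (negPf (C0 i1)) (negPf M10).
apply: (mulfI (C0 ord0)); apply/eqP; rewrite -subr_eq0; apply/eqP.
set m := M ord0 ord0 in e1 e2 *; set n := N ord0 ord0 in e3 e4 *.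
set c00 := C ord0 ord0 in e1 e3 *.
have f1 : C ord0 i1 * M i1 ord0 = th ord0 * c00 - c00 * m by rewrite -e1; ring.
have f2 : C i1 i1 * M i1 ord0 = th i1 * C i1 ord0 - C i1 ord0 * m
  by rewrite -e2; ring.
have f3 : N ord0 i1 * C i1 ord0 = c00 * ths ord0 - n * c00 by rewrite -e3; ring.
(* The product [N 0 1 * C 1 1 * M 1 0] is evaluated twice: through row 0 of [N] in [f4], through
   column 0 of [M] in [f5]. Equating the values and inserting [f1], [f3] gives [c00 * (th 0 - m) *
   (ths 1 - n) = c00 * (ths 0 - n) * (th 1 - m)]; the terms in [m * n] cancel. *)
have f4 : N ord0 i1 * (C i1 i1 * M i1 ord0) =
    C ord0 i1 * M i1 ord0 * (ths i1 - n).
  have -> : C ord0 i1 * M i1 ord0 * (ths i1 - n) =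
    M i1 ord0 * (C ord0 i1 * ths i1) - C ord0 i1 * M i1 ord0 * n by ring.
  by rewrite -e4; ring.
have f5 : N ord0 i1 * (C i1 i1 * M i1 ord0) =
    N ord0 i1 * C i1 ord0 * (th i1 - m) by rewrite f2; ring.
move: f5; rewrite f4 f1 f3 => /eqP; rewrite -subr_eq0 => /eqP f5.
rewrite -f5; ring.
Qed.

(** * Reversed orderings and the ratio identity for matrices *)

Lemma irr_tridiag_rev (F : fieldType) d (M : 'M[F]_d.+1) :
  is_irr_tridiag_mx M -> is_irr_tridiag_mx (mxsub (@rev_ord _) (@rev_ord _) M).
Proof.
move=> [triM irrM]; split=> i j; rewrite mxE.
  by move/triM => /=; have := ltn_ord i; have := ltn_ord j; lia.
by move=> ij; apply: irrM; move: ij => /=; have := ltn_ord i; have := ltn_ord j; lia.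
Qed.

(** Reversing the eigenbasis of [A^*] permutes the columns of [C]; this and its companion for [A]
    carry the corner identity to the other corners. *)
Lemma transition_revM (F : fieldType) d (M N C : 'M[F]_d.+1)
    (th ths : 'I_d.+1 -> F) :
  leonard_transition M N C th ths ->
  leonard_transition (mxsub (@rev_ord _) (@rev_ord _) M) N (colsub (@rev_ord _) C)
    th (ths \o @rev_ord _).
Proof.
case=> irrM irrN th_inj ths_inj C0 CM NC; split=> //.
- exact: irr_tridiag_rev.
- exact: inj_comp ths_inj rev_ord_inj.
- by move=> j; have [i Cij] := C0 (rev_ord j); exists i; rewrite mxE.
- move=> i j; rewrite mxE -CM (reindex_inj rev_ord_inj).
  by apply: eq_bigr => k _; rewrite !mxE rev_ordK.
- by move=> i j; rewrite mxE -NC; apply: eq_bigr => k _; rewrite mxE.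
Qed.

Lemma transition_revN (F : fieldType) d (M N C : 'M[F]_d.+1)
    (th ths : 'I_d.+1 -> F) :
  leonard_transition M N C th ths ->
  leonard_transition M (mxsub (@rev_ord _) (@rev_ord _) N) (rowsub (@rev_ord _) C)
    (th \o @rev_ord _) ths.
Proof.
case=> irrM irrN th_inj ths_inj C0 CM NC; split=> //.
- exact: irr_tridiag_rev.
- exact: inj_comp th_inj rev_ord_inj.
- by move=> j; have [i Cij] := C0 j; exists (rev_ord i); rewrite mxE rev_ordK.
- by move=> i j; rewrite mxE -CM; apply: eq_bigr => k _; rewrite mxE.
- move=> i j; rewrite mxE -NC (reindex_inj rev_ord_inj).
  by apply: eq_bigr => k _; rewrite !mxE rev_ordK.
Qed.

(** Besides the factors of the denominators, this records what makes the ratio an injective function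
    of each corner scalar. *)
Definition corners_neq (F : fieldType) d (a th : 'I_d.+1 -> F) : Prop :=
  [/\ th ord0 != th ord_max, a ord0 - th ord0 != 0, a ord0 - th ord_max != 0,
      a ord_max - th ord0 != 0 & a ord_max - th ord_max != 0].

Definition corner_ratio (F : fieldType) d (a th : 'I_d.+1 -> F) : F :=
  ((a ord0 - th ord0) * (a ord_max - th ord_max)) /
  ((a ord0 - th ord_max) * (a ord_max - th ord0)).

Lemma transition_corners (F : fieldType) d (M N C : 'M[F]_d.+1)
    (th ths : 'I_d.+1 -> F) :
  (0 < d)%N -> leonard_transition M N C th ths ->
  [/\ corners_neq (fun i => M i i) th, corners_neq (fun i => N i i) ths
    & corner_ratio (fun i => M i i) th = corner_ratio (fun i => N i i) ths].
Proof.
move=> d_gt0 lt; pose i1 : 'I_d.+1 := Ordinal (d_gt0 : (1 < d.+1)%N).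
have i1E : i1 = 1%N :> nat by [].
have rev0 : rev_ord (@ord0 d) = ord_max by apply: val_inj; rewrite /= subn1.
have i1n0 : i1 != ord0 by [].
have r1nm : rev_ord i1 != ord_max by rewrite -rev0 (inj_eq rev_ord_inj).
have [n1 e1] := transition_corner lt i1E.
have [n2 e2] := transition_corner (transition_revM lt) i1E.
have [n3 e3] := transition_corner (transition_revN lt) i1E.
have [n4 e4] := transition_corner (transition_revN (transition_revM lt)) i1E.
rewrite !mxE /= ?rev0 in n1 e1 n2 e2 n3 e3 n4 e4.
have neq (f : 'I_d.+1 -> F) i j : injective f -> i != j -> f j - f i != 0.
  by move=> f_inj ij; rewrite subr_eq0 eq_sym (inj_eq f_inj).
have n0 : ord0 != ord_max :> 'I_d.+1 by rewrite -val_eqE /= eq_sym -lt0n.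
have th0m : th ord0 != th ord_max by rewrite (inj_eq (lt_th_inj lt)).
have ths0m : ths ord0 != ths ord_max by rewrite (inj_eq (lt_ths_inj lt)).
have := neq _ _ _ (lt_th_inj lt) i1n0; have := neq _ _ _ (lt_ths_inj lt) i1n0.
have := neq _ _ _ (lt_th_inj lt) r1nm; have := neq _ _ _ (lt_ths_inj lt) r1nm.
move: e1 e2 e3 e4; rewrite -subr_eq0 in n1; rewrite -subr_eq0 in n2;
  rewrite -subr_eq0 in n3; rewrite -subr_eq0 in n4; move: n1 n2 n3 n4.
rewrite /corner_ratio /corners_neq.
(* With these names [e1], ..., [e4] read [al * x1 = ga * y1], [be * x2 = ga * y2],
   [al * x3 = de * y3], [be * x4 = de * y4]. *)
set al := ths _ - ths i1; set be := ths _ - ths (rev_ord i1).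
set ga := th _ - th i1; set de := th _ - th (rev_ord i1).
set x1 := M _ _ - _; set x2 := M _ _ - _; set x3 := M _ _ - _; set x4 := M _ _ - _.
set y1 := N _ _ - _; set y2 := N _ _ - _; set y3 := N _ _ - _; set y4 := N _ _ - _.
move=> n1 n2 n3 n4 e1 e2 e3 e4 be0 de0 al0 ga0.
have cross_neq (p q x y : F) : p != 0 -> x != 0 -> p * x = q * y -> y != 0.
  move=> p0 x0 e; have : q * y != 0 by rewrite -e mulf_neq0.
  by rewrite mulf_eq0 negb_or => /andP[].
have m1 := cross_neq _ _ _ _ al0 n1 e1; have m2 := cross_neq _ _ _ _ be0 n2 e2.
have m3 := cross_neq _ _ _ _ al0 n3 e3; have m4 := cross_neq _ _ _ _ be0 n4 e4.
split=> //; apply/eqP; rewrite eqr_div ?mulf_neq0 //; apply/eqP.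
have scal0 : (al * be) * (ga * de) != 0 by rewrite !mulf_neq0.
apply: (mulfI scal0).
(* Both cross products, scaled by [al * be * ga * de], regroup into sides of the four identities:
   [e1] and [e4] are used forwards, [e2] and [e3] backwards. *)
transitivity ((al * x1) * (be * x4) * ((ga * y2) * (de * y3))); first by ring.
by rewrite e1 e4 -e2 -e3; ring.
Qed.

(** * Coordinates, traces and eigenbases *)

Lemma coord_change (F : fieldType) (V : vectType F) n m (e : n.-tuple V)
    (f : m.-tuple V) (x : V) (i : 'I_n) :
  basis_of {:V} f -> coord e i x = \sum_(k < m) coord e i f`_k * coord f k x.
Proof.
move=> fb; rewrite {1}(coord_basis fb (memvf x)) linear_sum /=.
by apply: eq_bigr => k _; rewrite linearZ /= mulrC.
Qed.

(** The matrices of [g] in [f] and in [e] are [P *m Q] and [Q *m P], which have equal traces.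
    Rectangular factors avoid a cast between [n] and [\dim {:V}]. *)
Lemma lfun_trE (F : fieldType) (V : vectType F) n (e : n.-tuple V) (g : 'End(V)) :
  basis_of {:V} e -> lfun_tr g = \tr (lfun_mx e g).
Proof.
move=> eb; rewrite /lfun_tr; set f := vbasis _.
have fb : basis_of {:V} f := vbasisP _.
pose P := \matrix_(i < \dim {:V}, j < n) coord f i e`_j.
pose Q := \matrix_(i < n, j < \dim {:V}) coord e i (g f`_j).
have -> : lfun_mx f g = P *m Q.
  by apply/matrixP=> i j; rewrite !mxE (coord_change _ _ _ eb);
     apply: eq_bigr => k _; rewrite !mxE.
rewrite mxtrace_mulC; congr (\tr _); apply/matrixP=> i j; rewrite !mxE.
rewrite [in RHS](coord_basis fb (memvf e`_j)) !linear_sum /=.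
by apply: eq_bigr => k _; rewrite !mxE !linearZ /= mulrC.
Qed.

Lemma mem_leigenspace (F : fieldType) (V : vectType F) (A : 'End(V)) t x :
  (x \in passmx.leigenspace A t) = (A x == t *: x).
Proof.
by rewrite memv_ker add_lfunE opp_lfunE scale_lfunE id_lfunE subr_eq0.
Qed.

Lemma coord_eigen (F : fieldType) (V : vectType F) n (e : n.-tuple V)
    (A : 'End(V)) (th : 'I_n -> F) (i : 'I_n) (x : V) :
  basis_of {:V} e -> (forall k : 'I_n, A e`_k = th k *: e`_k) ->
  coord e i (A x) = th i * coord e i x.
Proof.
move=> eb Ae; rewrite {1}(coord_basis eb (memvf x)) !linear_sum (bigD1 i) //=.
rewrite big1 => [|k ki].
  rewrite !linearZ /= Ae linearZ /= coord_free ?(basis_free eb) // eqxx.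
  by rewrite mulr1 addr0 mulrC.
by rewrite !linearZ /= Ae linearZ /= coord_free ?(basis_free eb) // (negPf ki) !mulr0.
Qed.

(** One nonzero vector is picked in each eigenspace, and standardness makes these a Leonard
    basis. *)
Lemma standard_basis (F : fieldType) (V : vectType F) d (A B : 'End(V))
    (E : 'I_d.+1 -> 'End(V)) (th : 'I_d.+1 -> F) :
  is_standard_ordering A B E ->
  (forall i, is_primitive_idempotent A (th i) (E i)) ->
  exists v : d.+1.-tuple V,
    [/\ is_leonard_basis B A v, forall i : 'I_d.+1, A v`_i = th i *: v`_i,
        injective th
      & forall i, lfun_tr (B \o E i)%VF = lfun_mx v B i i].
Proof.
move=> [[E_inj _] E_std] Eth.
pose u i := vpick (passmx.leigenspace A (th i)).
have u_eig i : u i \in passmx.leigenspace A (th i) by apply: memv_pick.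
have Eu i : E i (u i) = u i by have [_ Eid _] := Eth i; apply: Eid.
pose v := [tuple u i | i < d.+1].
have vE (i : 'I_d.+1) : v`_i = u i by rewrite -tnth_nth tnth_mktuple.
have vL : is_leonard_basis B A v.
  apply: E_std => i; rewrite tnth_mktuple vpick0; have [ne _ _] := Eth i.
  by split=> //; rewrite -(Eu i) memv_img ?memvf.
have vb : basis_of {:V} v by case: vL.
have Av (i : 'I_d.+1) : A v`_i = th i *: v`_i.
  by apply/eqP; rewrite vE -mem_leigenspace.
(* If [th i = th j], then [E i] and [E j] agree on the basis [v], so they are equal and [i = j]. *)
have th_inj : injective th.
  move=> i j eq_th; apply: E_inj; apply/lfunP=> x.
  rewrite (coord_basis vb (memvf x)) !linear_sum; apply: eq_bigr => k _.
  rewrite !linearZ /= vE; congr (_ *: _).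
  have [_ Ei Ei0] := Eth i; have [_ Ej Ej0] := Eth j.
  have [ki | ki] := eqVneq (th k) (th i); last first.
    by rewrite (Ei0 _ _ ki) // (Ej0 (th k)) // -eq_th.
  by rewrite Ei ?Ej // -?eq_th -ki.
(* [E i] fixes [v_i] and kills the other basis vectors, so only the diagonal entry [i] contributes
   to the trace. *)
exists v; split=> // i; rewrite (lfun_trE _ vb) /mxtrace (bigD1 i) //= big1 => [|j ji].
  by rewrite addr0 !mxE lfunE /= vE Eu.
have [_ _ Ei0] := Eth i; rewrite mxE lfunE /= vE (Ei0 (th j)) ?linear0 //.
by rewrite (inj_eq th_inj).
Qed.

(** * From Leonard systems to transition matrices *)

(** Column [j] of [C] lists the coordinates of [v_j] in [w], where [w] and [v] are eigenbases of [A]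
    and [A^*]. The two product relations come from computing the [w]-coordinates of [A v_j] and of
    [A^* v_j] in two ways. *)
Lemma leonard_system_transition (F : fieldType) d (V : vectType F)
    (Phi : leonard_system d V) (th ths : 'I_d.+1 -> F) :
  is_eigenvalue_seq Phi th -> is_dual_eigenvalue_seq Phi ths ->
  exists M N C, [/\ leonard_transition M N C th ths,
    forall i, principal_seq Phi i = M i i
    & forall i, dual_principal_seq Phi i = N i i].
Proof.
move=> Eth Eths.
have [w [[wb irrN _] Aw th_inj trN]] := standard_basis (ls_standard Phi) Eth.
have [v [[vb irrM _] Asv ths_inj trM]] := standard_basis (ls_dual_standard Phi) Eths.
exists (lfun_mx v (lsA Phi)), (lfun_mx w (lsAs Phi)).
exists (\matrix_(i, j) coord w i v`_j); split=> //; split=> //.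
- move=> j; have [i wi | v0] := pickP (fun i => coord w i v`_j != 0).
    by exists i; rewrite mxE.
  have := free_not0 (basis_free vb) (mem_tnth j v); rewrite (tnth_nth 0).
  rewrite (coord_basis wb (memvf v`_j)) big1 ?eqxx // => i _.
  by rewrite (eqP (negbFE (v0 i))) scale0r.
- move=> i j; rewrite mxE -(coord_eigen _ _ wb Aw) (coord_change _ _ _ vb).
  by apply: eq_bigr => k _; rewrite !mxE.
- move=> i j; rewrite mxE mulrC -linearZ -Asv /= [in RHS](coord_basis wb (memvf v`_j)).
  by rewrite !linear_sum; apply: eq_bigr => k _; rewrite !mxE !linearZ /= mulrC.
Qed.

Lemma leonard_system_corners (F : fieldType) d (V : vectType F)
    (Phi : leonard_system d V) (th ths : 'I_d.+1 -> F) :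
  (0 < d)%N -> is_eigenvalue_seq Phi th -> is_dual_eigenvalue_seq Phi ths ->
  [/\ corners_neq (principal_seq Phi) th, corners_neq (dual_principal_seq Phi) ths
    & corner_ratio (principal_seq Phi) th
      = corner_ratio (dual_principal_seq Phi) ths].
Proof.
move=> d_gt0 Eth Eths.
have [M [N [C [lt aE asE]]]] := leonard_system_transition Eth Eths.
have := transition_corners d_gt0 lt.
by rewrite /corners_neq /corner_ratio !aE !asE.
Qed.

(** * Injectivity of the ratio and uniqueness *)

(** After cross-multiplication the difference of the two sides factors as
    [(p - q) * u * w * (x - y)]. *)
Lemma moebius_inj (F : fieldType) (p q u w x y : F) :
  p != q -> u != 0 -> w != 0 -> x - q != 0 -> y - q != 0 ->
  ((x - p) * u) / ((x - q) * w) = ((y - p) * u) / ((y - q) * w) -> x = y.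
Proof.
move=> pq u0 w0 xq yq /eqP; rewrite eqr_div ?mulf_neq0 // => /eqP e.
have c0 : (p - q) * u * w != 0 by rewrite !mulf_neq0 // subr_eq0.
apply: (mulfI c0); apply/eqP; rewrite -subr_eq0.
have -> : (p - q) * u * w * x - (p - q) * u * w * y =
  (x - p) * u * ((y - q) * w) - (y - p) * u * ((x - q) * w) by ring.
by rewrite e subrr.
Qed.

Lemma corner_ratio_inj (F : fieldType) d (a b th eta : 'I_d.+1 -> F) :
  th ord0 = eta ord0 -> th ord_max = eta ord_max ->
  corners_neq a th -> corners_neq b eta ->
  corner_ratio a th = corner_ratio b eta ->
  (a ord_max = b ord_max -> a ord0 = b ord0) /\
  (a ord0 = b ord0 -> a ord_max = b ord_max).
Proof.
rewrite /corner_ratio /corners_neq => <- <- [th_neq a1 a2 a3 a4] [_ _ b2 b3 _] ab.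
split=> e.
  by move: ab; rewrite -e; apply: moebius_inj.
move: ab; rewrite -e => ab.
(* In the variable [a ord_max] zero and pole trade places: the zero is [th ord_max], the pole
   [th ord0]. *)
apply: (moebius_inj (u := a ord0 - th ord0) (w := a ord0 - th ord_max)
  (p := th ord_max) (q := th ord0)) => //; first by rewrite eq_sym.
by rewrite ![(a ord_max - _) * _]mulrC ![(b ord_max - _) * _]mulrC.
Qed.

Theorem proposition1p10 (F : closedFieldType) (d : nat) (hd : (1 <= d)%N) :
  (forall (V : vectType F) (Phi : leonard_system d V)
          (theta thetas : 'I_d.+1 -> F),
     is_eigenvalue_seq Phi theta ->
     is_dual_eigenvalue_seq Phi thetas ->
     let a := principal_seq Phi in
     let as_ := dual_principal_seq Phi in
     [/\ (a ord0 - theta ord_max) * (a ord_max - theta ord0) != 0,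
         (as_ ord0 - thetas ord_max) * (as_ ord_max - thetas ord0) != 0
       & ((a ord0 - theta ord0) * (a ord_max - theta ord_max)) /
           ((a ord0 - theta ord_max) * (a ord_max - theta ord0)) =
         ((as_ ord0 - thetas ord0) * (as_ ord_max - thetas ord_max)) /
           ((as_ ord0 - thetas ord_max) * (as_ ord_max - thetas ord0))])
  /\
  (forall (V W : vectType F)
          (Phi : leonard_system d V) (Psi : leonard_system d W)
          (theta thetas eta etas : 'I_d.+1 -> F),
     is_eigenvalue_seq Phi theta ->
     is_dual_eigenvalue_seq Phi thetas ->
     is_eigenvalue_seq Psi eta ->
     is_dual_eigenvalue_seq Psi etas ->
     theta ord0 = eta ord0 -> theta ord_max = eta ord_max ->
     thetas ord0 = etas ord0 -> thetas ord_max = etas ord_max ->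
     let a := principal_seq Phi in
     let as_ := dual_principal_seq Phi in
     let b := principal_seq Psi in
     let bs := dual_principal_seq Psi in
     [/\ (a ord_max = b ord_max -> as_ ord0 = bs ord0 ->
            as_ ord_max = bs ord_max -> a ord0 = b ord0),
         (a ord0 = b ord0 -> as_ ord0 = bs ord0 ->
            as_ ord_max = bs ord_max -> a ord_max = b ord_max),
         (a ord0 = b ord0 -> a ord_max = b ord_max ->
            as_ ord_max = bs ord_max -> as_ ord0 = bs ord0)
       & (a ord0 = b ord0 -> a ord_max = b ord_max ->
            as_ ord0 = bs ord0 -> as_ ord_max = bs ord_max)]).

Proof.
split=> [V Phi theta thetas Eth Eths | V W Phi Psi theta thetas eta etas].
  have [[_ _ a2 a3 _] [_ _ s2 s3 _] e] := leonard_system_corners hd Eth Eths.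
  by split; rewrite ?mulf_neq0.
move=> Eth Eths Eeta Eetas th0 thm ths0 thsm a as_ b bs.
have [na ns e] := leonard_system_corners hd Eth Eths.
have [nb nt e'] := leonard_system_corners hd Eeta Eetas.
have inj := corner_ratio_inj th0 thm na nb.
have injs := corner_ratio_inj ths0 thsm ns nt.
(* Agreement of both scalars on one side equates the ratios there, hence by [e] and [e'] those on
   the other side, where injectivity yields the missing scalar. *)
have ratio_eq c c' t t' : t ord0 = t' ord0 -> t ord_max = t' ord_max ->
    c ord0 = c' ord0 -> c ord_max = c' ord_max ->
    corner_ratio c t = corner_ratio c' t' :> F.
  by rewrite /corner_ratio => -> -> -> ->.
split=> h1 h2 h3.
- by apply: (inj _).1 => //; rewrite e e'; apply: ratio_eq.
- by apply: (inj _).2 => //; rewrite e e'; apply: ratio_eq.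
- by apply: (injs _).1 => //; rewrite -e -e'; apply: ratio_eq.
- by apply: (injs _).2 => //; rewrite -e -e'; apply: ratio_eq.
Qed.
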